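(* Let $X\sim F$ be a nonnegative and continuous demand distribution with finite second moment. (i) If $X$ is strictly DGMRD and $c\ge1$ is a constant, then $r^*_X\le r^*_{cX}$. (ii) If $X$ is DMRD and $Z$ is a nonnegative, continuous demand distribution with finite second moment and independent of $X$, then $r^*_X\le\mathbf{r}^*_{X+Z}$, i.e. $r^*_X\le r^*_{X+Z}$ for any equilibrium wholesale price $r^*_{X+Z}$ of the $X+Z$ market.
   Context: For a nonnegative random variable $X$ with continuous (non-atomic) cdf $F$, $F(0)=0$, finite mean, $\bar F:=1-F$ and $H=\inf\{r\ge0:F(r)=1\}\in(0,\infty]$, the mean residual demand (MRD) function is $\mathrm{m}_X(r):=\mathbb{E}(X-r\mid X>r)=\frac{1}{\bar F(r)}\int_r^\infty\bar F(u)\,du$ for $r<H$ and $\mathrm{m}_X(r):=0$ otherwise. $X$ is DMRD if $\mathrm{m}_X$ is non-increasing. $X$ is (strictly) DGMRD if $\ell(r):=\mathrm{m}_X(r)/r$ is (strictly) decreasing on $(0,H)$. For a strictly DGMRD $X$ with finite second moment (in particular for a DMRD $X$), $r^*_X$ denotes the supplier's optimal wholesale price, i.e. the unique maximizer of $r\,\mathbb{E}(X-r)_+$ over $r\ge0$, where $(x)_+=\max\{0,x\}$; it is the unique solution of $r=\mathrm{m}_X(r)$. For a general demand $W$, $\mathbf{r}^*_W:=\{r\ge0: r=\mathrm{m}_W(r)\}$ denotes the set of all possible equilibrium wholesale prices. *)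

(* Defs.v *)
From HB Require Import structures.
From mathcomp Require Import all_boot all_order all_algebra.
From mathcomp Require Import all_classical all_reals all_analysis measurable_realfun.

Set Implicit Arguments.
Unset Strict Implicit.
Unset Printing Implicit Defensive.

Import Order.TTheory GRing.Theory Num.Theory.
Import numFieldNormedType.Exports.

Local Open Scope classical_set_scope.
Local Open Scope ring_scope.

Section demand.
Context (R : realType) (d : measure_display) (T : measurableType d)
  (P : probability T R).
Implicit Types X Z : {RV P >-> R}.

Definition continuous_demand X : Prop :=
  [/\ {ae P, forall t, (0 <= X t)%R},
      continuous (cdf X : R -> \bar R) &
      cdf X 0 = 0%E].

Definition finite_second_moment X : Prop :=
  ('E_P[fun t => ((X t) ^+ 2)%R] < +oo)%E.

(* The infimum is taken in \bar R, so it is +oo when F never reaches 1. *)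
Definition demand_sup X : \bar R :=
  ereal_inf [set r%:E | r in [set r : R | 0 <= r /\ cdf X r = 1%E]].

(* Conditional expectation given an event, E(f | A) = E(f 1_A) / P(A);
   meaningful when P A <> 0 and f is integrable on A. *)
Definition cond_expectation (f : T -> R) (A : set T) : R :=
  (\int[P]_(t in A) f t) / fine (P A).

Definition mrd X (r : R) : R :=
  if (r%:E < demand_sup X)%E
  then cond_expectation (fun t => X t - r) [set t | r < X t]
  else 0.

Definition gmrd X (r : R) : R := mrd X r / r.

Definition DMRD X : Prop :=
  forall r s : R, 0 <= r -> r <= s -> mrd X s <= mrd X r.

Definition strictly_DGMRD X : Prop :=
  forall r s : R, 0 < r -> r < s -> (s%:E < demand_sup X)%E ->
    gmrd X s < gmrd X r.

Definition supplier_profit X (r : R) : R :=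
  r * fine 'E_P[fun t => Num.max 0%R (X t - r)%R].

(* Uniqueness of the maximizer is not part of the predicate. *)
Definition optimal_price X (r : R) : Prop :=
  0 <= r /\ forall s : R, 0 <= s -> supplier_profit X s <= supplier_profit X r.

Definition equilibrium_prices X : set R := [set r | 0 <= r /\ r = mrd X r].

Definition independent_RV X Z : Prop :=
  forall A B : set R, measurable A -> measurable B ->
    P (X @^-1` A `&` Z @^-1` B) = (P (X @^-1` A) * P (Z @^-1` B))%E.

End demand.

(* Main.v *)
(** Let G(r) = E(W - r)_+, so that G(r) = m_W(r) P(W > r) for r >= 0.  Since
    -P(W > r) is a subgradient of G at r, a maximizer r of r G(r) satisfies
    G(r) = r P(W > r), that is r = m_W(r).
    (i) By homogeneity, r* maximizes the profit for cX iff r*/c does for X, and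
    strict DGMRD leaves at most one solution of m_X(r)/r = 1.
    (ii) If X is DMRD with optimum a, then E(X - u)_+ >= a P(X > u) for every
    u <= a, including u < 0.  Integrating over the values z of Z with u = r - z
    gives E(X + Z - r)_+ >= a P(X + Z > r) for r <= a, so that an equilibrium
    price r < a of the X + Z market would satisfy r >= a. *)
From HB Require Import structures.
Require Import Defs.
From mathcomp Require Import all_boot all_order all_algebra.
From mathcomp Require Import all_classical all_reals all_analysis measurable_realfun.
From mathcomp Require Import lra ring.

Import Order.TTheory GRing.Theory Num.Theory.
Import numFieldNormedType.Exports.

Set Implicit Arguments.
Unset Strict Implicit.
Unset Printing Implicit Defensive.

Local Open Scope classical_set_scope.
Local Open Scope ring_scope.

(** * The stop-loss transform G(r) = E(W - r)_+ and the tail of a single demand *)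

Section stop_loss.
Context {R : realType} {d : measure_display} {T : measurableType d}
  {P : probability T R}.
Implicit Types W X Z : {RV P >-> R}.

(** Convertible to the second factor of [supplier_profit], so that a profit unfolds to
    [r * stop_loss W r]. *)
Definition stop_loss W (r : R) : R :=
  fine 'E_P[fun t => Num.max 0 (W t - r)].

Definition tail W (r : R) : R := fine (P [set t | r < W t]).

Lemma measurable_gt W r : measurable [set t | r < W t].
Proof.
rewrite [X in measurable X](_ : _ = W @^-1` `]r, +oo[%classic).
  exact: measurable_funPTI.
by apply/seteqP; split => t /=; rewrite in_itv/= andbT.
Qed.

Lemma EFin_tail W r : (tail W r)%:E = P [set t | r < W t].
Proof. by rewrite fineK// fin_num_measure//; exact: measurable_gt. Qed.

Lemma tail_ge0 W r : 0 <= tail W r.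
Proof. exact: fine_ge0. Qed.

Lemma tail_le1 W r : tail W r <= 1.
Proof. by rewrite -lee_fin EFin_tail probability_le1//; exact: measurable_gt. Qed.

Lemma cdf_tail W r : cdf W r = (1 - tail W r)%:E.
Proof.
rewrite cdf_1_ccdf EFinB EFin_tail /ccdf /distribution /pushforward.
congr (1 - P _)%E.
by apply/seteqP; split => t /=; rewrite in_itv/= andbT.
Qed.

Lemma le_tail W r s : r <= s -> tail W s <= tail W r.
Proof.
move=> rs; rewrite -lee_fin !EFin_tail le_measure// ?inE; try exact: measurable_gt.
by move=> t /=; exact: le_lt_trans.
Qed.

Lemma excessE W r :
  (fun t => Num.max 0 (W t - r)) = (fun t => W t - r) \_ [set t | r < W t].
Proof.
apply/funext => t; rewrite patchE; case: ifPn => [|].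
  by rewrite inE/= => rW; apply/max_idPr; rewrite subr_ge0 ltW.
by rewrite notin_setE/= => /negP; rewrite -leNgt => Wr; apply/max_idPl; rewrite subr_le0.
Qed.

Lemma stop_loss_Rintegral W r :
  stop_loss W r = \int[P]_t Num.max 0 (W t - r).
Proof. by rewrite /stop_loss unlock. Qed.

Lemma stop_loss_ge0 W r : 0 <= stop_loss W r.
Proof.
by rewrite stop_loss_Rintegral; apply: Rintegral_ge0 => t _; rewrite le_max lexx.
Qed.

Lemma stop_lossE W r :
  stop_loss W r = \int[P]_(t in [set t | r < W t]) (W t - r).
Proof. by rewrite stop_loss_Rintegral excessE -Rintegral_mkcond. Qed.

Lemma measurable_excess W r : measurable_fun setT (fun t => Num.max 0 (W t - r)).
Proof. by apply: measurable_maxr => //; exact: measurable_funB. Qed.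

Section integrable_demand.
Context {W : {RV P >-> R}} (iW : P.-integrable setT (EFin \o W)).

Lemma integrable_excess r :
  P.-integrable setT (EFin \o (fun t => Num.max 0 (W t - r))).
Proof.
apply: (@le_integrable _ _ _ _ _ _ _ (EFin \o (fun t => `|W t| + `|r|))) => //.
- exact/measurable_EFinP/measurable_excess.
- move=> t _ /=; rewrite lee_fin (@ger0_norm _ (_ + _)) ?addr_ge0//.
  rewrite ger0_norm ?le_max ?lexx// ge_max addr_ge0//=.
  by apply: (le_trans (ler_norm _)); exact: ler_normB.
- have -> : EFin \o (fun t => `|W t| + `|r|) = (abse \o (EFin \o W)) \+ cst `|r|%:E.
    by apply/funext.
  apply: integrableD => //; first exact: integrable_abse.
  by apply: finite_measure_integrable_cst.
Qed.

(** Integrate the pointwise bound (w - r)_+ - (s - r) 1_{w > r} <= (w - s)_+. *)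
Lemma stop_loss_subgradient r s :
  stop_loss W r - (s - r) * tail W r <= stop_loss W s.
Proof.
have mA := measurable_gt W r.
have iA : P.-integrable setT (EFin \o (\1_[set t | r < W t] : T -> R)).
  by apply: integrable_indic => //; exact: fin_num_measure.
have -> : tail W r = \int[P]_t (\1_[set t | r < W t] t).
  by rewrite /Rintegral integral_indic// setIT.
rewrite -RintegralZl// !stop_loss_Rintegral -RintegralB//; last 2 first.
- exact: integrable_excess.
- exact: (integrableZl measurableT (s - r) iA).
apply: le_Rintegral => //.
- exact: (integrableB measurableT (integrable_excess r)
           (integrableZl measurableT (s - r) iA)).
- exact: integrable_excess.
- move=> t _; rewrite indicE.
  have [|] := boolP (t \in _);
    [rewrite inE/=|rewrite notin_setE/= => /negP; rewrite -leNgt].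
    move=> rW; rewrite mulr1 le_max; apply/orP; right.
    have -> : Num.max 0 (W t - r) = W t - r by apply/max_idPr; rewrite subr_ge0 ltW.
    lra.
  by move=> Wr; rewrite mulr0 subr0 (max_idPl _) ?subr_le0// le_max lexx.
Qed.

Lemma le_stop_loss r s : r <= s -> stop_loss W s <= stop_loss W r.
Proof.
move=> rs; apply: le_trans (stop_loss_subgradient s r).
by have := tail_ge0 W s; nra.
Qed.

Lemma stop_loss_gt0_tail r : 0 < stop_loss W r -> 0 < tail W r.
Proof.
rewrite [0 < tail _ _]lt_def tail_ge0 andbT => W0; apply: contraTN W0 => /eqP W0.
rewrite stop_lossE -leNgt /Rintegral null_set_integral//.
- exact: measurable_gt.
- by apply/measurable_EFinP/measurable_funTS; exact: measurable_funB.
- by transitivity (tail W r)%:E; [rewrite EFin_tail|rewrite W0].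
Qed.

(** If H <= r, some s < r + G(r) has zero tail. Yet G drops by less than G(r) between r and s, its
    slope being at most 1 in absolute value, so G(s) > 0 and the tail at s is positive. *)
Lemma lt_demand_sup_stop_loss r : 0 < stop_loss W r -> (r%:E < demand_sup W)%E.
Proof.
move=> W0; rewrite ltNge; apply/negP => Hr.
have [s [s0 /= Fs] sr] : exists2 s, 0 <= s /\ cdf W s = 1%E & s < r + stop_loss W r.
  have : (demand_sup W < (r + stop_loss W r)%:E)%E.
    by rewrite (le_lt_trans Hr)// lte_fin ltrDl.
  by move=> /ereal_inf_lt[_ [s ? <-]]; rewrite lte_fin; exists s.
have ts : tail W s = 0.
  by move: Fs; rewrite cdf_tail => -[]; lra.
have : 0 < stop_loss W s.
  apply: lt_le_trans (stop_loss_subgradient r s).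
  by have := tail_ge0 W r; have := tail_le1 W r; have [] := leP r s; nra.
by move/stop_loss_gt0_tail; rewrite ts ltxx.
Qed.

Lemma mrd_tail r : 0 <= r -> mrd W r * tail W r = stop_loss W r.
Proof.
move=> r0; rewrite /mrd; case: ifPn => rH; last first.
  rewrite mul0r; apply/esym/eqP; rewrite eq_le stop_loss_ge0 andbT leNgt.
  (* At or beyond H, [mrd] takes its default value 0, and G vanishes there too. *)
  by apply: contra rH; exact: lt_demand_sup_stop_loss.
have t0 : tail W r != 0.
  apply: contraTN rH => /eqP t0; rewrite -leNgt; apply: ereal_inf_lbound.
  by exists r => //; split=> //; rewrite cdf_tail t0 subr0.
by rewrite /cond_expectation -stop_lossE divfK.
Qed.

(* First-order condition: the subgradient inequality at r bounds the profit
   difference below by (s - r) (E(W - r)_+ - s P(W > r)), with sign decided by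
   s near r on either side; no differentiability is needed. *)
Lemma optimal_price_fixpoint r : 0 < stop_loss W 0 -> optimal_price W r ->
  [/\ 0 < r, 0 < stop_loss W r & mrd W r = r].
Proof.
rewrite /optimal_price /supplier_profit => W0 [r0 ropt].
have {}ropt s : 0 <= s -> s * stop_loss W s <= r * stop_loss W r by exact: ropt.
have profit0 : 0 < r * stop_loss W r.
  (* The price s = G(0)/2 earns a positive profit, since G(s) >= G(0) - s. *)
  have s0 : 0 < stop_loss W 0 / 2 by lra.
  apply: lt_le_trans (ropt (stop_loss W 0 / 2) (ltW s0)).
  rewrite mulr_gt0//; apply: lt_le_trans (stop_loss_subgradient 0 _).
  by have := tail_ge0 W 0; have := tail_le1 W 0; nra.
have {}r0 : 0 < r.
  by rewrite lt_def r0 andbT; apply: contraTneq profit0 => ->; rewrite mul0r ltxx.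
have Wr : 0 < stop_loss W r by rewrite -(pmulr_rgt0 _ r0).
have t0 := stop_loss_gt0_tail Wr.
split=> //.
have mono s : 0 <= s -> (s - r) * (stop_loss W r - s * tail W r) <= 0.
  move=> s0; have := ropt s s0; have := stop_loss_subgradient r s.
  by move=> /(ler_wpM2l s0); nra.
apply: (mulIf (lt0r_neq0 t0)); rewrite mrd_tail ?ltW//.
apply/eqP; rewrite eq_le; apply/andP; split.
- apply/ler_addgt0Pr => e e0.
  have e' : 0 < e / tail W r by rewrite divr_gt0.
  have := mono (r + e / tail W r) (addr_ge0 (ltW r0) (ltW e')).
  rewrite addrC addKr mulrDl divfK ?gt_eqF//.
  by rewrite pmulr_rle0// subr_le0 addrC.
- rewrite -subr_ge0 leNgt; apply/negP => neg.
  (* The root of the second factor in [mono]. If it lies below r, both factors are negative at the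
     midpoint of s and r. *)
  pose s := stop_loss W r / tail W r.
  have s0 : 0 < s by rewrite divr_gt0.
  have ss : s * tail W r = stop_loss W r by rewrite divfK ?gt_eqF.
  have sr : s < r by rewrite -(ltr_pM2r t0) ss; lra.
  have := mono ((s + r) / 2) ltac:(lra).
  by rewrite -ss; nra.
Qed.

End integrable_demand.

Lemma finite_second_moment_integrable W :
  finite_second_moment W -> P.-integrable setT (EFin \o W).
Proof.
rewrite /finite_second_moment unlock => W2.
have i2 : P.-integrable setT (EFin \o (fun t => (W t) ^+ 2)).
  apply/integrableP; split; first by apply/measurable_EFinP; exact: measurable_funX.
  by apply: le_lt_trans W2; under eq_integral do rewrite gee0_abs ?lee_fin ?sqr_ge0//.
apply: (@le_integrable _ _ _ _ _ _ _ (EFin \o (fun t => (W t) ^+ 2) \+ cst 1%:E)) => //.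
- exact/measurable_EFinP.
- move=> t _ /=; rewrite lee_fin [leRHS]ger0_norm ?addr_ge0 ?sqr_ge0//.
  rewrite -(real_normK (num_real (W t))).
  (* From (|w| - 1)^2 >= 0 follows 2|w| <= w^2 + 1. *)
  by have := sqr_ge0 (`|W t| - 1); have := normr_ge0 (W t); nra.
- by apply: integrableD => //; exact: finite_measure_integrable_cst.
Qed.

End stop_loss.

(** * Integrals over a pair of independent variables *)

Section independence.
Context {R : realType} {d : measure_display} {T : measurableType d}
  {P : probability T R}.
Implicit Types X Z : {RV P >-> R}.
Local Open Scope ereal_scope.

(** Independence fixes the joint law on rectangles, hence it is the product law by uniqueness of
    product measures; Tonelli then puts Z in the outer integral. *)
Lemma independent_integral X Z (f : R * R -> \bar R) :
    independent_RV X Z -> measurable_fun setT f -> (forall p, 0 <= f p) ->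
  \int[P]_t f (X t, Z t) = \int[P]_s \int[P]_t f (X t, Z s).
Proof.
move=> indep mf f0.
have mXZ : measurable_fun setT (fun t => (X t, Z t)) by exact: measurable_fun_pair.
pose XZ : {mfun T >-> (R * R)%type} :=
  HB.pack (fun t => (X t, Z t)) (isMeasurableFun.Build _ _ _ _ _ mXZ).
transitivity (\int[distribution P XZ]_p f p).
  by rewrite ge0_integral_distribution.
have joint : forall A, measurable A ->
    (distribution P X \x distribution P Z) A = distribution P XZ A.
  by apply: product_measure_unique => A B mA mB; rewrite -indep.
rewrite (eq_measure_integral (distribution P X \x distribution P Z)); last first.
  by move=> A mA _; apply: esym; exact: joint.
rewrite fubini_tonelli2// ge0_integral_distribution//; last 2 first.
- exact: measurable_fun_fubini_tonelli_G.
- by move=> z; exact: integral_ge0.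
apply: eq_integral => s _ /=; rewrite /fubini_G ge0_integral_distribution//.
exact: measurableT_comp.
Qed.

Lemma measurable_fun_partial_integral X Z (f : R * R -> \bar R) :
    measurable_fun setT f -> (forall p, 0 <= f p) ->
  measurable_fun setT (fun s => \int[P]_t f (X t, Z s)).
Proof.
move=> mf f0.
apply: (measurable_fun_fubini_tonelli_G (fun p : T * T => f (X p.1, Z p.2))) => //.
apply: measurableT_comp => //.
by apply: measurable_fun_pair; exact: measurableT_comp.
Qed.

End independence.

(** * Adding an independent nonnegative demand *)

Section independent_sum.
Context {R : realType} {d : measure_display} {T : measurableType d}
  {P : probability T R}.
Implicit Types X Z : {RV P >-> R}.

(* Conditioning on Z = z shifts the threshold r for X to r - z <= r. *)
Lemma stop_loss_add X Z (a r : R) : 0 <= a -> independent_RV X Z ->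
    P.-integrable setT (EFin \o X) -> P.-integrable setT (EFin \o Z) ->
    {ae P, forall t, 0 <= Z t} ->
    (forall u, u <= r -> a * tail X u <= stop_loss X u) ->
  a * tail (P := P) (X \+ Z) r <= stop_loss (P := P) (X \+ Z) r.
Proof.
move=> a0 indep iX iZ Z0 aX.
pose f (p : R * R) := (Num.max 0 (p.1 + p.2 - r))%:E.
pose g (p : R * R) := (a * \1_[set q : R * R | r < q.1 + q.2] p)%:E.
have mD : measurable_fun setT (fun p : R * R => p.1 + p.2) by exact: measurable_funD.
have mf : measurable_fun setT f.
  apply/measurable_EFinP; apply: measurable_maxr => //.
  exact: measurable_funB.
have mg : measurable_fun setT g.
  apply/measurable_EFinP; apply: measurable_funM => //; apply: measurable_indic.
  rewrite [X in measurable X](_ : _ =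
      (fun p : R * R => p.1 + p.2) @^-1` `]r, +oo[%classic).
    by rewrite -[X in measurable X]setTI; exact: mD.
  by apply/seteqP; split => t /=; rewrite in_itv/= andbT.
have f0 p : (0 <= f p)%E by rewrite lee_fin le_max lexx.
have g0 p : (0 <= g p)%E by rewrite lee_fin mulr_ge0.
have ifW (W : {RV P >-> R}) u : P.-integrable setT (EFin \o W) ->
    (stop_loss W u)%:E = (\int[P]_t (Num.max 0 (W t - u))%:E)%E.
  move=> iW; rewrite stop_loss_Rintegral fineK//.
  by rewrite integrable_fin_num// integrable_excess.
have igW (W : {RV P >-> R}) u :
    (a * tail W u)%:E = (\int[P]_t (a * \1_[set t | u < W t] t)%:E)%E.
  have mu := measurable_gt W u.
  under eq_integral do rewrite EFinM.
  rewrite ge0_integralZl_EFin//; last by apply/measurable_EFinP/measurable_indic.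
  by rewrite integral_indic// setIT EFinM EFin_tail.
rewrite -lee_fin igW ifW; last exact: (integrableD measurableT iX iZ).
rewrite -[leLHS]/(\int[P]_t g (X t, Z t))%E -[leRHS]/(\int[P]_t f (X t, Z t))%E.
(* With Z outermost, it suffices to compare the inner integrals for almost every value of Z. *)
rewrite !independent_integral//; apply: ae_ge0_le_integral => //.
- by move=> s _; exact: integral_ge0.
- exact: measurable_fun_partial_integral.
- by move=> s _; exact: integral_ge0.
- exact: measurable_fun_partial_integral.
apply: filterS Z0 => s Zs _.
have := aX (r - Z s) ltac:(by rewrite lerBlDr lerDl).
rewrite -lee_fin igW ifW//.
under eq_integral => t _.
  rewrite (_ : \1__ _ = \1_[set q : R * R | r < q.1 + q.2] (X t, Z s)); last first.
    rewrite !indicE; congr (_%:R); congr nat_of_bool.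
    by apply/idP/idP; rewrite !inE/= ltrBlDr.
  over.
move=> /le_trans; apply.
by under eq_integral do rewrite opprB addrA (addrC _ (Z s)) (addrC (Z s)).
Qed.

(** Almost surely X > r implies X + Z > r. This keeps the tail of the sum positive, so that it can
    be cancelled. *)
Lemma le_tail_add X Z r : {ae P, forall t, 0 <= Z t} ->
  tail X r <= tail (P := P) (X \+ Z) r.
Proof.
move=> Z0; rewrite -lee_fin !EFin_tail -!expectation_indic; try exact: measurable_gt.
apply: expectation_le.
- by apply: measurable_indic; exact: measurable_gt.
- by apply: measurable_indic; exact: measurable_gt.
- by [].
- by [].
apply: filterS Z0 => t Zt; rewrite !indicE ler_nat.
have [|//] := boolP (t \in [set t | r < X t]); rewrite inE/= => rX.
by rewrite mem_set//= (lt_le_trans rX)// lerDl.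
Qed.

End independent_sum.

(** * Scaling, uniqueness of the optimum, and the DMRD bound *)

Section optimal_prices.
Context {R : realType} {d : measure_display} {T : measurableType d}
  {P : probability T R}.
Implicit Types X Z : {RV P >-> R}.

Lemma stop_loss_scale X (c s : R) : 0 < c -> P.-integrable setT (EFin \o X) ->
  stop_loss (P := P) (scale_mfun c X) s = c * stop_loss X (s / c).
Proof.
move=> c0 iX; rewrite !stop_loss_Rintegral -RintegralZl//; last exact: integrable_excess.
apply: eq_Rintegral => t _ /=.
by rewrite maxr_pMr ?(ltW c0)// mulr0 mulrBr mulrCA divff ?gt_eqF// mulr1 (mulrC c).
Qed.

Lemma optimal_price_scale X (c r : R) : 0 < c -> P.-integrable setT (EFin \o X) ->
  optimal_price (P := P) (scale_mfun c X) r -> optimal_price X (r / c).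
Proof.
move=> c0 iX [r0 ropt]; split=> [|s s0]; first by rewrite divr_ge0// ltW.
have := ropt (c * s) (mulr_ge0 (ltW c0) s0).
rewrite /supplier_profit -!/(stop_loss _ _) !stop_loss_scale//.
rewrite (mulrC c s) mulfK ?gt_eqF// => h.
(* The profit of cX at price cs is c^2 times that of X at s. *)
rewrite -(ler_pM2l (mulr_gt0 c0 c0)); move: h; congr (_ <= _); first by ring.
by field; rewrite gt_eqF.
Qed.

Lemma continuous_demand_tail0 X : continuous_demand X -> tail X 0 = 1.
Proof. by move=> [_ _]; rewrite cdf_tail => -[]; lra. Qed.

(** If G(0) = 0, the subgradient at r > 0 evaluated at 0 gives G(r) + r P(X > r) <= 0, so F = 1 on
    all r > 0; right-continuity then contradicts F(0) = 0. *)
Lemma continuous_demand_mean_gt0 X : continuous_demand X ->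
  P.-integrable setT (EFin \o X) -> 0 < stop_loss X 0.
Proof.
move=> [_ _ X0] iX; rewrite lt_def stop_loss_ge0 andbT; apply/eqP => EX0.
suff : cdf X r @[r --> 0^'+] --> 1%E.
  move=> cvg1; have /eqP : 1%E = cdf X 0.
    by apply: (cvg_unique _ cvg1) => //; exact: cdf_right_continuous.
  by rewrite X0 onee_eq0.
apply: cvg_near_cst; near=> r.
have r0 : 0 < r by [].
have := stop_loss_subgradient iX r 0; rewrite EX0 sub0r cdf_tail => h.
suff -> : tail X r = 0 by rewrite subr0.
by have := stop_loss_ge0 X r; have := tail_ge0 X r; nra.
Unshelve. all: by end_near. Qed.

(** Both optima have m_X(r)/r = 1, and G > 0 at the larger one places it below H, where strict
    decrease applies. Exchanging r and s gives equality. *)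
Lemma strictly_DGMRD_optimal_unique X (r s : R) : strictly_DGMRD X ->
    P.-integrable setT (EFin \o X) -> 0 < stop_loss X 0 ->
  optimal_price X r -> optimal_price X s -> r <= s.
Proof.
move=> dX iX X0 ropt sopt; rewrite leNgt; apply/negP => sr.
have [r0 Xr mr] := optimal_price_fixpoint iX X0 ropt.
have [s0 _ ms] := optimal_price_fixpoint iX X0 sopt.
have := dX _ _ s0 sr (lt_demand_sup_stop_loss iX Xr).
by rewrite /gmrd mr ms !divff ?gt_eqF// ltxx.
Qed.

(** For u >= 0, m_X(u) >= m_X(a) = a. For u < 0, which arises as r - z, G(u) >= G(0) = m_X(0) >= a
    >= a P(X > u). *)
Lemma DMRD_stop_loss X (a u : R) : DMRD X -> P.-integrable setT (EFin \o X) ->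
    tail X 0 = 1 -> mrd X a = a -> 0 <= a -> u <= a ->
  a * tail X u <= stop_loss X u.
Proof.
move=> dX iX X0 ma a0 ua; have [u0|/ltW u0] := leP 0 u.
  by rewrite -(mrd_tail iX u0) ler_wpM2r ?tail_ge0// -{1}ma; exact: dX.
apply: le_trans (le_stop_loss iX u0); rewrite -(mrd_tail iX (lexx 0)) X0 mulr1.
apply: (le_trans (ler_piMr a0 (tail_le1 X u))).
by rewrite -{1}ma; exact: dX.
Qed.

End optimal_prices.

Theorem theorem4p5 (R : realType) (d : measure_display) (T : measurableType d)
    (P : probability T R) (X : {RV P >-> R})
    (hX : continuous_demand X) (hX2 : finite_second_moment X) :
  (strictly_DGMRD X ->
     forall c : R, 1 <= c ->
     forall rX rcX : R,
       optimal_price X rX -> optimal_price (P := P) (scale_mfun c X) rcX ->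
       rX <= rcX) /\
  (DMRD X ->
     forall Z : {RV P >-> R},
       continuous_demand Z -> finite_second_moment Z -> independent_RV X Z ->
     forall rX : R, optimal_price X rX ->
     forall r : R, equilibrium_prices (P := P) (X \+ Z) r -> rX <= r).
Proof.
have iX := finite_second_moment_integrable hX2.
have X0 := continuous_demand_mean_gt0 hX iX.
split=> [dX c c1 rX rcX Xopt cXopt|dX Z [Z0 _ _] hZ2 indep rX Xopt r [r0 mr]].
  have c0 : 0 < c by lra.
  (* This gives [rX <= rcX / c], and [rcX / c <= rcX] because c >= 1. *)
  have := strictly_DGMRD_optimal_unique dX iX X0 Xopt (optimal_price_scale c0 iX cXopt).
  move=> /le_trans; apply; have [rcX0 _] := cXopt.
  by rewrite ler_pdivrMr// ler_peMr.
have iZ := finite_second_moment_integrable hZ2.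
have [rX0 XrX mX] := optimal_price_fixpoint iX X0 Xopt.
rewrite leNgt; apply/negP => rrX.
have tr : 0 < tail (P := P) (X \+ Z) r.
  apply: lt_le_trans (stop_loss_gt0_tail XrX) _.
  exact: le_trans (le_tail X (ltW rrX)) (le_tail_add X r Z0).
have := stop_loss_add (ltW rX0) indep iX iZ Z0 (fun u ur =>
  DMRD_stop_loss dX iX (continuous_demand_tail0 hX) mX (ltW rX0) (le_trans ur (ltW rrX))).
(* The equilibrium equation turns the right side into r P(X + Z > r); cancelling the positive tail
   leaves [rX <= r]. *)
rewrite -(@mrd_tail _ _ _ P (X \+ Z) (integrableD measurableT iX iZ) _ r0) -mr.
by rewrite ler_pM2r// leNgt rrX.
Qed.
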